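(* Let $n,m\ge 1$, and let $\beta>1$ and $\rho>0$ be real numbers with $2\beta^2\rho(\rho+2)<1$. Let $\hat\Sigma_t\in\mathbb{R}^{n\times(n+m)}$ be a matrix and let $\Sigma_t\in\mathbb{R}^{(n+m)\times(n+m)}$ be a symmetric positive definite matrix. Let $(A,B)\in\mathcal{M}_\beta$, where $A\in\mathbb{R}^{n\times n}$ and $B\in\mathbb{R}^{n\times m}$, and let $P\in\mathbb{R}^{n\times n}$ be a symmetric positive definite solution of the Riccati equation $$P=\min_{K}\left[I+K^\top K+(A+BK)^\top P(A+BK)\right].$$ Suppose that $$\left\|\begin{bmatrix}A&B\end{bmatrix}-\hat\Sigma_t\Sigma_t^{-1}\right\|\le\rho .$$ Then the data-driven Riccati equation $$\Sigma_t\left(Q_t-I\right)\Sigma_t=\hat\Sigma_t^\top\min_{K}\left(\begin{bmatrix}I\\ K\end{bmatrix}^\top Q_t\begin{bmatrix}I\\ K\end{bmatrix}\right)\hat\Sigma_t$$ has a symmetric positive definite solution $Q_t\in\mathbb{R}^{(n+m)\times(n+m)}$ whose minimizer $K_t\in\mathbb{R}^{m\times n}$ on the right-hand side satisfies $$\frac{1}{1-2\beta^2\rho(\rho+2)}\,P\succeq I+K_t^\top K_t+(A+BK_t)^\top P(A+BK_t).$$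
   Context: For symmetric matrices, $\succeq$, $\preceq$, $\succ$ denote the Loewner (positive semidefinite) order; $\|\cdot\|$ is the spectral (operator) norm. All minima over $K\in\mathbb{R}^{m\times n}$ of symmetric-matrix-valued expressions are minima in the Loewner order. In particular, for a symmetric positive definite $Q=\begin{bmatrix}Q^{xx}&Q^{xu}\\ Q^{ux}&Q^{uu}\end{bmatrix}\in\mathbb{R}^{(n+m)\times(n+m)}$ with $Q^{xx}\in\mathbb{R}^{n\times n}$, $$\min_K\begin{bmatrix}I\\ K\end{bmatrix}^\top Q\begin{bmatrix}I\\ K\end{bmatrix}=Q^{xx}-Q^{xu}(Q^{uu})^{-1}Q^{ux},$$ and the minimizer (minimizing argument) is $K=-(Q^{uu})^{-1}Q^{ux}$. For $\beta>1$, $\mathcal{M}_\beta$ is the set of all pairs $(A,B)\in\mathbb{R}^{n\times n}\times\mathbb{R}^{n\times m}$ such that the equation $$Q-I=\begin{bmatrix}A&B\end{bmatrix}^\top\min_{K}\left(\begin{bmatrix}I\\ K\end{bmatrix}^\top Q\begin{bmatrix}I\\ K\end{bmatrix}\right)\begin{bmatrix}A&B\end{bmatrix}$$ has a symmetric solution $Q\in\mathbb{R}^{(n+m)\times(n+m)}$ with $I\preceq Q\preceq\beta^2I$. *)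

(* Defs.v *)
From HB Require Import structures.
From mathcomp Require Import all_boot all_order all_algebra.
From mathcomp Require Import boolp classical_sets reals.

Set Implicit Arguments.
Unset Strict Implicit.
Unset Printing Implicit Defensive.

Import Order.TTheory GRing.Theory Num.Theory.
Local Open Scope ring_scope.
Local Open Scope classical_set_scope.

(* Semidefiniteness and definiteness include symmetry. *)
Definition psdmx (R : realType) (k : nat) (M : 'M[R]_k) : Prop :=
  M^T = M /\ forall x : 'cV[R]_k, 0 <= (x^T *m M *m x) 0 0.

Definition pdmx (R : realType) (k : nat) (M : 'M[R]_k) : Prop :=
  M^T = M /\ forall x : 'cV[R]_k, x != 0 -> 0 < (x^T *m M *m x) 0 0.

Definition loewner_le (R : realType) (k : nat) (M N : 'M[R]_k) : Prop :=
  psdmx (N - M).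

(* The library norm on matrices is the max norm, hence these definitions. *)
Definition euclid_norm (R : realType) (k : nat) (x : 'cV[R]_k) : R :=
  Num.sqrt (\sum_i x i 0 ^+ 2).

Definition spectral_norm (R : realType) (p q : nat) (M : 'M[R]_(p, q)) : R :=
  sup [set euclid_norm (M *m x) | x in [set x | euclid_norm x <= 1]].

Definition loewner_argmin (R : realType) (T : Type) (k : nat)
    (F : T -> 'M[R]_k) (K : T) : Prop :=
  forall K', loewner_le (F K) (F K').

(* V = min_K F K: the Loewner order is partial, so the minimum is a relation
   that also asserts that it is attained. *)
Definition is_loewner_min (R : realType) (T : Type) (k : nat)
    (F : T -> 'M[R]_k) (V : 'M[R]_k) : Prop :=
  exists2 K, loewner_argmin F K & V = F K.

Definition quad (R : realType) (n m : nat) (Q : 'M[R]_(n + m))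
    (K : 'M[R]_(m, n)) : 'M[R]_n :=
  (col_mx 1%:M K)^T *m Q *m col_mx 1%:M K.

Definition lqr_cost (R : realType) (n m : nat) (A : 'M[R]_n)
    (B : 'M[R]_(n, m)) (P : 'M[R]_n) (K : 'M[R]_(m, n)) : 'M[R]_n :=
  1%:M + K^T *m K + (A + B *m K)^T *m P *m (A + B *m K).

Definition Mset (R : realType) (n m : nat) (beta : R) :
    set ('M[R]_n * 'M[R]_(n, m)) :=
  [set AB | exists Q : 'M[R]_(n + m),
    [/\ Q^T = Q, loewner_le 1%:M Q, loewner_le Q (beta ^+ 2)%:M &
        exists2 V : 'M[R]_n, is_loewner_min (quad Q) V &
          Q - 1%:M = (row_mx AB.1 AB.2)^T *m V *m row_mx AB.1 AB.2]].

Definition data_riccati (R : realType) (n m : nat)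
    (hatSigma : 'M[R]_(n, n + m)) (Sigma Q : 'M[R]_(n + m)) : Prop :=
  exists2 V : 'M[R]_n, is_loewner_min (quad Q) V &
    Sigma *m (Q - 1%:M) *m Sigma = hatSigma^T *m V *m hatSigma.

(* Main.v *)
Require Import Defs.
From mathcomp Require Import all_boot all_order all_algebra.
From mathcomp Require Import boolp classical_sets reals.
From mathcomp Require Import topology normedtype sequences.
From mathcomp Require Import ring lra.

Set Implicit Arguments.
Unset Strict Implicit.
Unset Printing Implicit Defensive.

Import Order.TTheory GRing.Theory Num.Theory.
Local Open Scope ring_scope.
Local Open Scope classical_set_scope.
Import numFieldNormedType.Exports.

(** Write G = [A B] and Gh = hatSigma Sigma^-1, and let qfun G X = I + G^T X G
be the Q-matrix of a quadratic value X under the dynamics G.  Eliminating Q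
from its own equation, a solution of either Riccati equation for Q is
Q = qfun G X, where the value X is the Loewner minimum over K of
quad (qfun G X) K, the cost of playing K for one step and paying X afterwards.
In the data-driven equation, cancelling Sigma on both sides puts Gh in the
place of G.  All the work therefore happens at the level of values, where
everything is an inequality between quadratic forms.

The constant is d = beta^2 rho (rho + 2).  Membership in M_beta gives a
value V below beta^2 I with G^T V G below beta^2 I, and P lies below V
[Mset_value_bound], so both bounds hold for P.  Expanding P along
Gh = G - (G - Gh) with a Young inequality of parameter rho gives
|P(Gh y) - P(G y)| <= d |y|^2 [perturbed_form_close].  Three facts follow.

- The multiple P / (1 - d) is a supersolution for Gh, under the gain that is
  optimal for P.  Monotone iteration from 0 below it produces a value Y of
  the data-driven equation with Y <= P / (1 - d) [riccati_solution].

- Conversely P <= (1 + d) Y [riccati_comparison].  With K the gain optimal for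
  Y, the difference D = P - (1 + d) Y satisfies D <= T^T D T along the closed
  loop T of Gh under K; since Y strictly decreases along T, iterating shows
  that D <= 0 [stein_nonpos].

- The true cost of K against P is at most (1 + d) times the data cost of K
  against Y, that is (1 + d) Y, hence at most ((1 + d) / (1 - d)) P.

Finally (1 + d) / (1 - d) <= 1 / (1 - 2 d) because
(1 + d) (1 - 2 d) = 1 - d - 2 d^2. *)

(** * Quadratic forms *)

Definition qform (R : realType) (k : nat) (M : 'M[R]_k) (x : 'cV[R]_k) : R :=
  (x^T *m M *m x) 0 0.

Definition sqn (R : realType) (k : nat) (x : 'cV[R]_k) : R := (x^T *m x) 0 0.

Definition qfun (R : realType) (n p : nat) (G : 'M[R]_(n, p)) (X : 'M[R]_n) :=
  1%:M + G^T *m X *m G.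

Section RiccatiPerturbation.
Variable R : realType.

Lemma qformD k (M N : 'M[R]_k) x : qform (M + N) x = qform M x + qform N x.
Proof. by rewrite /qform mulmxDr mulmxDl mxE. Qed.

Lemma qformN k (M : 'M[R]_k) x : qform (- M) x = - qform M x.
Proof. by rewrite /qform mulmxN mulNmx mxE. Qed.

Lemma qformB k (M N : 'M[R]_k) x : qform (M - N) x = qform M x - qform N x.
Proof. by rewrite qformD qformN. Qed.

Lemma qformZ k a (M : 'M[R]_k) x : qform (a *: M) x = a * qform M x.
Proof. by rewrite /qform -scalemxAr -scalemxAl mxE. Qed.

Lemma qformZr k a (M : 'M[R]_k) (x : 'cV[R]_k) :
  qform M (a *: x) = a ^+ 2 * qform M x.
Proof.
rewrite /qform; have -> : (a *: x)^T = a *: x^T by apply/rowP => i; rewrite !mxE.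
by rewrite -scalemxAr -!scalemxAl scalerA mxE expr2.
Qed.

Lemma qform0 k (x : 'cV[R]_k) : qform 0 x = 0.
Proof. by rewrite /qform mulmx0 mul0mx mxE. Qed.

Lemma qform1 k (x : 'cV[R]_k) : qform 1%:M x = sqn x.
Proof. by rewrite /qform mulmx1. Qed.

Lemma qform_scalar k a (x : 'cV[R]_k) : qform a%:M x = a * sqn x.
Proof. by rewrite -scalemx1 qformZ qform1. Qed.

Lemma qform_congr k l (M : 'M[R]_k) (G : 'M[R]_(k, l)) x :
  qform (G^T *m M *m G) x = qform M (G *m x).
Proof. by rewrite /qform trmx_mul !mulmxA. Qed.

Lemma qformE k (M : 'M[R]_k) x :
  qform M x = \sum_i \sum_j x j 0 * M j i * x i 0.
Proof.
rewrite /qform mxE; apply: eq_bigr => i _.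
by rewrite mxE mulr_suml; apply: eq_bigr => j _; rewrite mxE.
Qed.

Lemma sqnE k (x : 'cV[R]_k) : sqn x = \sum_i x i 0 ^+ 2.
Proof. by rewrite /sqn mxE; apply: eq_bigr => i _; rewrite mxE expr2. Qed.

Lemma sqn_ge0 k (x : 'cV[R]_k) : 0 <= sqn x.
Proof. by rewrite sqnE sumr_ge0 // => i _; rewrite sqr_ge0. Qed.

Lemma sqn_eq0 k (x : 'cV[R]_k) : (sqn x == 0) = (x == 0).
Proof.
rewrite sqnE psumr_eq0 => [|i _]; last exact: sqr_ge0.
apply/idP/eqP => [/allP h|->]; last by apply/allP => i _; rewrite mxE expr0n /=.
apply/colP => i; rewrite mxE; apply/eqP.
by have := h i (mem_index_enum i); rewrite sqrf_eq0.
Qed.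

Lemma sqn0 k : sqn (0 : 'cV[R]_k) = 0.
Proof. by apply/eqP; rewrite sqn_eq0. Qed.

Lemma sqn_gt0 k (x : 'cV[R]_k) : x != 0 -> 0 < sqn x.
Proof. by move=> x0; rewrite lt_neqAle sqn_ge0 eq_sym sqn_eq0 x0. Qed.

Lemma sqn_col k l (x : 'cV[R]_k) (y : 'cV[R]_l) :
  sqn (col_mx x y) = sqn x + sqn y.
Proof. by rewrite /sqn tr_col_mx mul_row_col mxE. Qed.

Lemma entry_sqr_le k (x : 'cV[R]_k) i : x i 0 ^+ 2 <= sqn x.
Proof.
rewrite sqnE (bigD1 i) //= lerDl sumr_ge0 // => j _; exact: sqr_ge0.
Qed.

(** A crude bound, linear in the entries, so that entrywise convergence of
matrices gives convergence of forms uniformly on the unit ball. *)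
Lemma qform_le_entries k (M : 'M[R]_k) x :
  qform M x <= (\sum_i \sum_j `|M j i|) * sqn x.
Proof.
rewrite qformE mulr_suml; apply: ler_sum => i _.
rewrite mulr_suml; apply: ler_sum => j _.
apply: le_trans (ler_norm _) _.
rewrite mulrAC mulrC normrM ler_wpM2l //.
have [hi hj] := (entry_sqr_le x i, entry_sqr_le x j).
rewrite -(ger0_norm (sqn_ge0 x)) -ler_sqr ?nnegrE // -!normrX.
rewrite !ger0_norm ?exprn_even_ge0 // exprMn expr2.
by apply: ler_pM => //; exact: sqr_ge0.
Qed.

Lemma qform_bounded k (M : 'M[R]_k) :
  exists2 c, 0 < c & forall x, qform M x <= c * sqn x.
Proof.
have s0 : 0 <= \sum_i \sum_j `|M j i|.
  by apply: sumr_ge0 => i _; apply: sumr_ge0.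
exists (\sum_i \sum_j `|M j i| + 1) => [|x]; first lra.
apply: le_trans (qform_le_entries M x) _.
by rewrite ler_wpM2r ?sqn_ge0 // lerDl.
Qed.

Lemma loewner_leP k (M N : 'M[R]_k) : M^T = M -> N^T = N ->
  loewner_le M N <-> forall x, qform M x <= qform N x.
Proof.
move=> Ms Ns; split=> [[_ h] x|h].
  by rewrite -subr_ge0 -qformB; exact: h.
by split=> [|x]; [rewrite linearB /= Ms Ns|rewrite -/(qform _ x) qformB subr_ge0].
Qed.

Lemma loewner_le_qform k (M N : 'M[R]_k) x : loewner_le M N ->
  qform M x <= qform N x.
Proof. by case=> _ h; rewrite -subr_ge0 -qformB; exact: h. Qed.

Lemma bform_sym k (M : 'M[R]_k) (x y : 'cV[R]_k) : M^T = M ->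
  (y^T *m M *m x) 0 0 = (x^T *m M *m y) 0 0.
Proof.
by move=> Ms; rewrite -[in LHS](trmxK (y^T *m M *m x)) mxE !trmx_mul trmxK Ms mulmxA.
Qed.

Lemma qform_add k (M : 'M[R]_k) (x y : 'cV[R]_k) : M^T = M ->
  qform M (x + y) = qform M x + 2 * (x^T *m M *m y) 0 0 + qform M y.
Proof.
move=> Ms; rewrite /qform.
have -> : (x + y)^T = x^T + y^T by apply/rowP => i; rewrite !mxE.
rewrite !mulmxDl !mulmxDr.
have mxD (U V : 'M[R]_1) : (U + V) 0 0 = U 0 0 + V 0 0 by rewrite mxE.
by rewrite !mxD (bform_sym x y Ms); ring.
Qed.

(** Polarization: the entries are linear in finitely many values of the form,
so symmetric matrices converge as soon as their forms converge pointwise. *)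
Lemma sym_entryE k (M : 'M[R]_k) i j : M^T = M ->
  M i j = (qform M (delta_mx i 0 + delta_mx j 0) - qform M (delta_mx i 0)
           - qform M (delta_mx j 0)) / 2.
Proof.
move=> Ms; rewrite qform_add //.
have -> : ((delta_mx i 0 : 'cV[R]_k)^T *m M *m (delta_mx j 0 : 'cV[R]_k)) 0 0 = M i j.
  by rewrite trmx_delta -rowE -colE !mxE.
by field.
Qed.

Lemma sym_eq_qform k (M N : 'M[R]_k) : M^T = M -> N^T = N ->
  (forall x, qform M x = qform N x) -> M = N.
Proof.
by move=> Ms Ns MN; apply/matrixP => i j; rewrite !sym_entryE // !MN.
Qed.

(** * Monotone limits and stability *)

Lemma cvg_sum2 k (f : 'I_k -> 'I_k -> nat -> R) (a : 'I_k -> 'I_k -> R) :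
    (forall i j, f i j n @[n --> \oo] --> a i j) ->
  (\sum_i \sum_j f i j n) @[n --> \oo] --> \sum_i \sum_j a i j.
Proof.
move=> fa; apply: (cvg_big add_continuous) => i _.
by apply: (cvg_big add_continuous) => j _; exact: fa.
Qed.

(** The forms converge pointwise, being monotone and bounded, hence so do the
entries, and the limit is approached uniformly on the unit ball.  The last
clause is what allows the vector at which the forms are compared to vary with
the index, as it does when gains depend on the iterate. *)
Lemma loewner_monotone_limit k (u : nat -> 'M[R]_k) (W : 'M[R]_k) :
    (forall i, (u i)^T = u i) ->
    (forall i x, qform (u i) x <= qform (u i.+1) x) ->
    (forall i x, qform (u i) x <= qform W x) ->
  exists L, [/\ L^T = L, forall i x, qform (u i) x <= qform L x,
    forall x b, (forall i, qform (u i) x <= b) -> qform L x <= b &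
    forall e, 0 < e -> exists i, forall x,
      qform L x <= qform (u i) x + e * sqn x].
Proof.
move=> us umono ubd.
have mono x : {homo (fun n => qform (u n) x) : p q / (p <= q)%N >-> p <= q}.
  by apply/nondecreasing_seqP => n; exact: umono.
have cvq x : cvgn (fun n => qform (u n) x).
  apply: nondecreasing_is_cvgn (mono x) _.
  by exists (qform W x) => _ [n _ <-]; exact: ubd.
have cve i j : cvgn (fun n => u n i j).
  rewrite (_ : (fun n => _) = fun n =>
    (qform (u n) (delta_mx i 0 + delta_mx j 0) - qform (u n) (delta_mx i 0)
           - qform (u n) (delta_mx j 0)) / 2).
    apply: is_cvgM; last exact: is_cvg_cst.
    by apply: is_cvgB; [apply: is_cvgB|]; exact: cvq.
  by apply/funext => n; exact: sym_entryE.
pose L : 'M[R]_k := \matrix_(i, j) limn (fun n => u n i j).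
have cvL i j : u n i j @[n --> \oo] --> L i j by rewrite mxE; exact: cve.
have cvLq x : qform (u n) x @[n --> \oo] --> qform L x.
  rewrite qformE; under eq_fun do rewrite qformE.
  apply: cvg_sum2 => i j.
  by apply: cvgM; [apply: cvgM; [exact: cvg_cst|]|exact: cvg_cst].
exists L; split=> [|i x|x b ub|e e0].
- apply/matrixP => i j; rewrite !mxE; congr (limn _); apply/funext => n.
  by rewrite -[in LHS](us n) mxE.
- by rewrite -(cvg_lim _ (cvLq x)) //; exact: nondecreasing_cvgn_le.
- rewrite -(cvg_lim _ (cvLq x)) //; apply: limr_le; first exact: cvq.
  by near=> i; exact: ub.
have cvd i j : `|(L - u n) j i| @[n --> \oo] --> `|L j i - L j i|.
  apply: cvg_norm; under eq_fun do rewrite mxE [X in _ + X]mxE.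
  by apply: cvgB; [exact: cvg_cst|exact: cvL].
have lim0 : \sum_(i < k) \sum_(j < k) `|L j i - L j i| < e.
  by rewrite big1 // => i _; rewrite big1 // => j _; rewrite subrr normr0.
have [n _ hn] := cvgr_lt _ (cvg_sum2 cvd) _ lim0.
exists n => x; rewrite -lerBlDl -qformB.
apply: le_trans (qform_le_entries _ x) _.
by rewrite ler_wpM2r ?sqn_ge0 // ltW //; apply: hn => /=.
Unshelve. all: by end_near. Qed.

(** A discrete Lyapunov argument: Y contracts by a factor q < 1 along T, so a
bound D <= c Y improves to D <= q c Y, and then to D <= q^j c Y for all j. *)
Lemma stein_nonpos k (Y D T : 'M[R]_k) :
    (forall x, 0 <= qform Y x) ->
    (forall x, sqn x + qform Y (T *m x) <= qform Y x) ->
    (forall x, qform D x <= qform D (T *m x)) ->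
  forall x, qform D x <= 0.
Proof.
move=> Y_ge0 YT DT x.
have [M M_gt0 YM] := qform_bounded Y.
have [d d_gt0 Dd] := qform_bounded D.
(* Y <= M I turns the decrease |x|^2 into the fraction Y / (M + 1); the
   shift by 1 keeps q nonnegative. *)
pose q := 1 - (M + 1)^-1.
have M1_gt0 : 0 < M + 1 by lra.
have q_ge0 : 0 <= q by rewrite subr_ge0 invf_le1 //; lra.
have q_lt1 : q < 1 by rewrite ltrBlDr ltrDl invr_gt0.
have Yq y : qform Y (T *m y) <= q * qform Y y.
  have sY : (M + 1)^-1 * qform Y y <= sqn y.
    rewrite mulrC ler_pdivrMr // (le_trans (YM y)) // mulrC.
    by rewrite ler_wpM2l ?sqn_ge0 //; lra.
  by have := YT y; rewrite /q mulrBl mul1r; lra.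
have Dq j : forall y, qform D y <= q ^+ j * d * qform Y y.
  elim: j => [|j IH] y.
    rewrite expr0 mul1r (le_trans (Dd y)) // ler_wpM2l ?(ltW d_gt0) //.
    by have := YT y; have := Y_ge0 (T *m y); lra.
  apply: le_trans (DT y) _; apply: le_trans (IH (T *m y)) _.
  have -> : q ^+ j.+1 * d * qform Y y = q ^+ j * d * (q * qform Y y).
    by rewrite exprSr; ring.
  by rewrite ler_wpM2l // mulr_ge0 ?exprn_ge0 // ltW.
have cv : (fun j => q ^+ j * (d * qform Y x)) @ \oo --> 0.
  rewrite -[X in _ --> X](mul0r (d * qform Y x)).
  by apply: cvgM; [apply: cvg_expr; rewrite ger0_norm|exact: cvg_cst].
rewrite -(cvg_lim _ cv) //; apply: limr_ge; first by apply/cvg_ex; exists 0.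
by near=> j; rewrite mulrA Dq.
Unshelve. all: by end_near. Qed.

(** * Minimizing over gains *)

Lemma qfun_sym n p (G : 'M[R]_(n, p)) X : X^T = X -> (qfun G X)^T = qfun G X.
Proof. by move=> Xs; rewrite /qfun linearD /= trmx1 !trmx_mul trmxK Xs mulmxA. Qed.

Lemma qform_qfun n p (G : 'M[R]_(n, p)) X y :
  qform (qfun G X) y = sqn y + qform X (G *m y).
Proof. by rewrite qformD qform1 qform_congr. Qed.

Lemma quad_sym n m (Q : 'M[R]_(n + m)) (K : 'M[R]_(m, n)) :
  Q^T = Q -> (quad Q K)^T = quad Q K.
Proof. by move=> Qs; rewrite /quad !trmx_mul trmxK Qs mulmxA. Qed.

Lemma qform_quad n m (Q : 'M[R]_(n + m)) (K : 'M[R]_(m, n)) x :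
  qform (quad Q K) x = qform Q (col_mx x (K *m x)).
Proof. by rewrite /quad qform_congr mul_col_mx mul1mx. Qed.

Lemma qform_quad_qfun n m (G : 'M[R]_(n, n + m)) X (K : 'M[R]_(m, n)) x :
  qform (quad (qfun G X) K) x =
  sqn (col_mx x (K *m x)) + qform X (G *m col_mx x (K *m x)).
Proof. by rewrite qform_quad qform_qfun. Qed.

Lemma sqn_le_col n m (x : 'cV[R]_n) (y : 'cV[R]_m) : sqn x <= sqn (col_mx x y).
Proof. by rewrite sqn_col lerDl sqn_ge0. Qed.

Lemma lqr_cost_quad n m (A : 'M[R]_n) (B : 'M[R]_(n, m)) P K :
  lqr_cost A B P K = quad (qfun (row_mx A B) P) K.
Proof.
rewrite /lqr_cost /quad /qfun; set S := col_mx _ _; set G := row_mx _ _.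
have -> : 1%:M + K^T *m K = S^T *m S.
  by rewrite tr_col_mx mul_row_col trmx1 mul1mx.
have -> : A + B *m K = G *m S by rewrite mul_row_col mulmx1.
by rewrite trmx_mul mulmxDr mulmx1 mulmxDl !mulmxA.
Qed.

Lemma pdmx_unit k (M : 'M[R]_k) : pdmx M -> M \in unitmx.
Proof.
move=> [_ Mpd]; rewrite -row_free_unit -kermx_eq0.
apply/eqP/row_matrixP => i; rewrite row0.
have /sub_kermxP : (row i (kermx M) <= kermx M)%MS by exact: row_sub.
set v := row i _ => vM.
have [//|v0] := eqVneq v 0.
have vT0 : v^T != 0 by rewrite -trmx0 (inj_eq trmx_inj).
by have := Mpd _ vT0; rewrite trmxK vM mul0mx mxE ltxx.
Qed.

(** Completing the square: K = - Quu^-1 Qux makes the lower block of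
Q [x; K x] vanish, so the cross term with any change of gain is zero. *)
Lemma quad_argmin_exists n m (Q : 'M[R]_(n + m)) : pdmx Q ->
  exists K, loewner_argmin (quad Q) K.
Proof.
move=> [Qs Qpd]; set u := drsubmx Q; set w := dlsubmx Q.
have Q_ge0 z : 0 <= qform Q z.
  have [->|z0] := eqVneq z 0; last exact/ltW/Qpd.
  by rewrite /qform mulmx0 mxE.
have u_unit : u \in unitmx.
  apply: pdmx_unit; split; first by rewrite /u trmx_drsub Qs.
  move=> y y0; have := Qpd (col_mx 0 y); rewrite -[in col_mx 0 y != _]col_mx0.
  have -> : ((col_mx 0 y)^T *m Q *m col_mx (0 : 'cV[R]_n) y) 0 0
            = (y^T *m u *m y) 0 0.
    rewrite -mulmxA -{1}(submxK Q) mul_block_col tr_col_mx mul_row_col.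
    by rewrite !mulmx0 !add0r trmx0 mul0mx add0r mulmxA.
  apply; apply: contraNneq y0 => /(congr1 dsubmx).
  by rewrite !col_mxKd => ->.
pose K := - (invmx u *m w); exists K => K'.
apply/loewner_leP; [exact: quad_sym|exact: quad_sym|move=> x].
rewrite !qform_quad; set z := col_mx x (K *m x).
pose e := (K' - K) *m x.
have -> : col_mx x (K' *m x) = z + col_mx 0 e.
  by rewrite add_col_mx addr0 /e mulmxBl addrC subrK.
rewrite qform_add // bform_sym //.
have -> : ((col_mx 0 e)^T *m Q *m z) 0 0 = 0.
  rewrite -mulmxA -{1}(submxK Q) mul_block_col tr_col_mx mul_row_col.
  rewrite -/u -/w trmx0 mul0mx add0r /K mulNmx mulmxN mulmxA mulmxA.
  by rewrite mulmxV // mul1mx subrr mulmx0 mxE.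
by rewrite mulr0 addr0 lerDl.
Qed.

Lemma qfun_pd n p (G : 'M[R]_(n, p)) X : psdmx X -> pdmx (qfun G X).
Proof.
move=> [Xs X0]; split; first exact: qfun_sym.
move=> y y0; rewrite -/(qform _ y) qform_qfun ltr_pwDl ?sqn_gt0 //.
exact: X0.
Qed.

(** * Riccati equations: existence and comparison *)

(** Value iteration u_(i+1) = min_K quad (qfun G u_i) K from u_0 = 0 is monotone
and stays below the supersolution W; its limit is the required fixed point.
That the limit L satisfies F L <= L is obtained without continuity of the
minimizing gain: comparing with the gain of the i-th iterate, and using
L <= u_i + e L for large i, gives (1 - e) F L <= u_(i+1) <= L. *)
Lemma riccati_solution n m (G : 'M[R]_(n, n + m)) (W : 'M[R]_n) K0 :
    (forall x, 0 <= qform W x) ->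
    (forall x, qform (quad (qfun G W) K0) x <= qform W x) ->
  exists X, [/\ psdmx X, forall x, qform X x <= qform W x &
                is_loewner_min (quad (qfun G X)) X].
Proof.
move=> W_ge0 W_super.
(* The iteration needs the gain as a function of all matrices X; the guard
   covers those for which no minimizing gain exists. *)
have gainP X : {K | psdmx X -> loewner_argmin (quad (qfun G X)) K}.
  apply: cid; have [Xpsd|nXpsd] := EM (psdmx X); last by exists 0.
  by have [K KP] := quad_argmin_exists (qfun_pd G Xpsd); exists K.
pose K X := sval (gainP X); pose F X := quad (qfun G X) (K X).
have F_le X K' x : psdmx X -> qform (F X) x <= qform (quad (qfun G X) K') x.
  by move=> Xpsd; apply/loewner_le_qform/(svalP (gainP X) Xpsd).
have sqn_F X x : psdmx X -> sqn x <= qform (F X) x.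
  move=> [_ X0]; rewrite qform_quad_qfun (le_trans (sqn_le_col x (K X *m x))) //.
  by rewrite lerDl; exact: X0.
have F_psd X : psdmx X -> psdmx (F X).
  move=> Xpsd; split; first by case: Xpsd => Xs _; exact/quad_sym/qfun_sym.
  by move=> x; exact: le_trans (sqn_ge0 x) (sqn_F X x Xpsd).
have F_mono X Y : psdmx X -> (forall x, qform X x <= qform Y x) ->
    forall K' x, qform (F X) x <= qform (quad (qfun G Y) K') x.
  move=> Xpsd XY K' x; apply: le_trans (F_le X K' x Xpsd) _.
  by rewrite !qform_quad_qfun lerD2l.
pose u i := iter i F 0.
have u_psd i : psdmx (u i).
  elim: i => [|i IH]; last exact: F_psd.
  by split=> [|x]; [rewrite trmx0|rewrite -/(qform _ x) qform0].
have u_mono i x : qform (u i) x <= qform (u i.+1) x.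
  elim: i x => [|i IH] x; last exact: F_mono.
  by rewrite [u 0]/= qform0; exact: (u_psd 1).2.
have u_le_W i x : qform (u i) x <= qform W x.
  elim: i x => [|i IH] x; first by rewrite qform0.
  exact: le_trans (F_mono _ W (u_psd i) IH K0 x) (W_super x).
have [L [Ls u_le_L L_lub L_approx]] :=
  loewner_monotone_limit (fun i => (u_psd i).1) u_mono u_le_W.
have sqn_L x : sqn x <= qform L x.
  exact: le_trans (sqn_F _ x (u_psd 0)) (u_le_L 1 x).
have L_psd : psdmx L.
  by split=> // x; exact: le_trans (sqn_ge0 x) (sqn_L x).
have L_le_F x : qform L x <= qform (F L) x.
  by apply: L_lub => i; apply: le_trans (u_mono i x) _; apply: F_mono.
have F_le_L x : qform (F L) x <= qform L x.
  apply/ler_addgt0Pr => e e0.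
  have FL0 : 0 <= qform (F L) x by exact: (F_psd _ L_psd).2.
  have s1 : 0 < qform (F L) x + 1 by lra.
  have [|i hi] := L_approx (e / (qform (F L) x + 1)); first exact: divr_gt0.
  set d := e / _ in hi.
  have d0 : 0 < d by exact: divr_gt0.
  have dF : d * qform (F L) x <= e.
    by rewrite /d mulrAC ler_pdivrMr // ler_wpM2l ?(ltW e0) //; lra.
  have := F_le L (K (u i)) x L_psd; rewrite qform_quad_qfun.
  have := u_le_L i.+1 x; rewrite [u i.+1]/= qform_quad_qfun.
  set z := col_mx _ _; have := hi (G *m z).
  have := ler_wpM2l (ltW d0) (sqn_L (G *m z)).
  have := sqn_ge0 z; have := L_psd.2 (G *m z); rewrite -/(qform _ _).
  (* Dividing by 1 - d is only possible for d < 1; for d >= 1 the choice of d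
     already forces F L <= e. *)
  have [d1|d1] := lerP 1 d.
    have := L_psd.2 x; rewrite -/(qform _ _).
    have := ler_wpM2r FL0 d1; lra.
  set a := qform L (G *m z); set b := qform (u i) _; set f := qform (F L) x.
  set l := qform L x => a0 z0 h1 h2 h3 h4.
  have : (1 - d) * f <= (1 - d) * (sqn z + a) by apply: ler_wpM2l => //; lra.
  have : 0 <= d * sqn z by rewrite mulr_ge0 // ltW.
  rewrite -/f in dF; lra.
have FL : F L = L.
  apply: sym_eq_qform => //; first exact: (F_psd _ L_psd).1.
  by move=> x; apply/eqP; rewrite eq_le F_le_L L_le_F.
exists L; split=> //.
  by move=> x; apply: L_lub => i; exact: u_le_W.
by exists (K L) => //; exact: (svalP (gainP L) L_psd).
Qed.

(** Inflating the supersolution Y by 1 + d pays for replacing G by Gh at every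
step: the running cost of [x; K x] is its squared norm, the same quantity that
bounds the error.  Hence P - (1 + d) Y does not decrease along the closed loop
of Gh under K, and [stein_nonpos] applies. *)
Lemma riccati_comparison n m (G Gh : 'M[R]_(n, n + m)) (P Y : 'M[R]_n)
    (K : 'M[R]_(m, n)) (d : R) :
    0 <= d ->
    (forall x, 0 <= qform Y x) ->
    (forall y, qform P (G *m y) <= qform P (Gh *m y) + d * sqn y) ->
    (forall x, qform P x <= qform (quad (qfun G P) K) x) ->
    (forall x, qform (quad (qfun Gh Y) K) x <= qform Y x) ->
  forall x, qform P x <= (1 + d) * qform Y x.
Proof.
move=> d0 Y0 PG PK YK x; rewrite -subr_le0 -qformZ -qformB.
have TE y : Gh *m col_mx 1%:M K *m y = Gh *m col_mx y (K *m y).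
  by rewrite -mulmxA mul_col_mx mul1mx.
apply: (@stein_nonpos _ Y _ (Gh *m col_mx 1%:M K)) => // y.
  apply: le_trans (YK y); rewrite TE qform_quad_qfun lerD2r.
  exact: sqn_le_col.
rewrite !qformB !qformZ TE.
have := PK y; have := YK y; rewrite !qform_quad_qfun.
set z := col_mx _ _; have := PG z.
set a := qform P (Gh *m z); set b := qform Y (Gh *m z) => h1 h2 h3.
have : (1 + d) * (sqn z + b) <= (1 + d) * qform Y y by rewrite ler_wpM2l //; lra.
lra.
Qed.

(** The value V = min_K quad Q K attached to the Q given by M_beta satisfies
V <= Q^xx <= beta^2 I and I + G^T V G = Q <= beta^2 I.  Both bounds pass to P,
which lies below V by the comparison with G = Gh and d = 0. *)
Lemma Mset_value_bound n m (A : 'M[R]_n) (B : 'M[R]_(n, m)) (P : 'M[R]_n)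
    (beta : R) :
    Mset beta (A, B) ->
    (forall K x, qform P x <= qform (quad (qfun (row_mx A B) P) K) x) ->
  (forall x, qform P x <= beta ^+ 2 * sqn x) /\
  (forall y, qform P (row_mx A B *m y) <= beta ^+ 2 * sqn y).
Proof.
set G := row_mx A B => -[Q [_ Q_ge Q_le [V [K0 K0_min VE] QE]]] P_le.
have Q_qfun : Q = qfun G V by rewrite /qfun -QE addrC subrK.
have V_ge0 x : 0 <= qform V x.
  rewrite VE qform_quad; apply: le_trans (loewner_le_qform _ Q_ge).
  by rewrite qform1 sqn_ge0.
have P_le_V x : qform P x <= qform V x.
  have -> : qform V x = (1 + 0) * qform V x by rewrite addr0 mul1r.
  apply: (@riccati_comparison _ _ G G P V K0) => // [y|y].
    by rewrite mul0r addr0.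
  by rewrite -Q_qfun -VE.
split=> [x|y]; apply: le_trans (P_le_V _) _.
  rewrite VE; apply: le_trans (loewner_le_qform x (K0_min 0)) _.
  rewrite qform_quad mul0mx; apply: le_trans (loewner_le_qform _ Q_le) _.
  by rewrite qform_scalar sqn_col sqn0 addr0.
have := loewner_le_qform y Q_le; rewrite Q_qfun qform_qfun qform_scalar.
by have := sqn_ge0 y; lra.
Qed.

(** * Perturbation of the dynamics *)

(** Young's inequality 2 |g^T P e| <= r P(g) + P(e) / r for g = G y and
e = (G - Gh) y; the parameter r balances the two terms at b r |y|^2 each. *)
Lemma perturbed_form_close n p (P : 'M[R]_n) (G Gh : 'M[R]_(n, p)) (b r : R) :
    psdmx P -> 0 <= b -> 0 < r ->
    (forall x, qform P x <= b * sqn x) ->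
    (forall y, qform P (G *m y) <= b * sqn y) ->
    (forall y, sqn ((G - Gh) *m y) <= r ^+ 2 * sqn y) ->
  forall y, `|qform P (Gh *m y) - qform P (G *m y)| <= b * r * (r + 2) * sqn y.
Proof.
move=> [Ps P0] b0 r0 Pb PGb Er y.
set g := G *m y; pose e := (G - Gh) *m y.
have -> : Gh *m y = g + - e by rewrite /e mulmxBl opprB addrC subrK.
have QN : qform P (- e) = qform P e by rewrite -scaleN1r qformZr sqrrN expr1n mul1r.
(* Young's inequality in both signs, scaled by r. *)
have h1 : 0 <= qform P (r *: g + - e) := P0 _.
have h2 : 0 <= qform P (r *: g + e) := P0 _.
rewrite !qform_add // ?QN qformZr in h1 h2.
have hg := PGb y; rewrite -/g in hg.
have he : qform P e <= b * (r ^+ 2 * sqn y).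
  by apply: le_trans (Pb e) _; rewrite ler_wpM2l //; exact: Er.
rewrite qform_add // QN.
have c1 : ((r *: g)^T *m P *m - e) 0 0 = - (r * (g^T *m P *m e) 0 0).
  have -> : (r *: g)^T = r *: g^T by apply/rowP => i; rewrite !mxE.
  by rewrite mulmxN -!scalemxAl mxE [X in - X]mxE.
have c2 : ((r *: g)^T *m P *m e) 0 0 = r * (g^T *m P *m e) 0 0.
  have -> : (r *: g)^T = r *: g^T by apply/rowP => i; rewrite !mxE.
  by rewrite -!scalemxAl mxE.
have c3 : (g^T *m P *m - e) 0 0 = - (g^T *m P *m e) 0 0 by rewrite mulmxN mxE.
rewrite {}c1 in h1; rewrite {}c2 in h2; rewrite {}c3.
have e0 := P0 e; rewrite -/(qform _ _) in e0.
move: h1 h2 hg he e0; set s := sqn y; set c := (g^T *m P *m e) 0 0.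
set pg := qform P g; set pe := qform P e => h1 h2 hg he e0.
have rg : r * (r * pg) <= r * (r * (b * s)) by rewrite !ler_wpM2l // ltW.
have k1 : 2 * c <= 2 * (b * r * s).
  by rewrite -(ler_pM2l r0); lra.
have k2 : - (2 * c) <= 2 * (b * r * s).
  by rewrite -(ler_pM2l r0); lra.
by rewrite ler_norml; apply/andP; split; lra.
Qed.

Lemma euclid_norm_sqn k (x : 'cV[R]_k) : euclid_norm x = Num.sqrt (sqn x).
Proof. by rewrite /euclid_norm sqnE. Qed.

(** The supremum defining the norm is only meaningful once the image of the
unit ball is known to be bounded, which [qform_bounded] provides for M^T M. *)
Lemma spectral_norm_sqn p q (M : 'M[R]_(p, q)) (r : R) :
  spectral_norm M <= r -> forall x, sqn (M *m x) <= r ^+ 2 * sqn x.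
Proof.
move=> Mr x; have [->|x0] := eqVneq x 0.
  by rewrite mulmx0 !sqn0 mulr0.
have sx := sqn_gt0 x0; pose a := (Num.sqrt (sqn x))^-1.
have a2 : a ^+ 2 = (sqn x)^-1 by rewrite exprVn sqr_sqrtr // ltW.
have sqnZ k (y : 'cV[R]_k) : sqn (a *: y) = a ^+ 2 * sqn y.
  by rewrite -!qform1 qformZr.
have [c c0 Mc] := qform_bounded (M^T *m M).
have Mle y : sqn y <= 1 -> euclid_norm (M *m y) <= r.
  move=> y1; apply: le_trans Mr; apply: ub_le_sup; last first.
    by exists y => //=; rewrite euclid_norm_sqn -sqrtr1 ler_wsqrtr.
  exists (Num.sqrt c) => _ [z /= z1 <-].
  rewrite euclid_norm_sqn ler_wsqrtr // -qform1 -qform_congr mulmx1.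
  apply: le_trans (Mc z) _; rewrite -[leRHS]mulr1 ler_wpM2l ?(ltW c0) //.
  rewrite -(@ler_sqrt _ _ 1) // sqrtr1; move: z1; by rewrite euclid_norm_sqn.
have : euclid_norm (M *m (a *: x)) <= r.
  by apply: Mle; rewrite sqnZ a2 mulVf // gt_eqF.
rewrite -scalemxAr euclid_norm_sqn sqnZ a2 => h.
have r0 : 0 <= r by apply: le_trans h; exact: sqrtr_ge0.
have := h; rewrite -ler_sqr ?nnegrE ?sqrtr_ge0 // sqr_sqrtr; last first.
  by rewrite mulr_ge0 ?sqn_ge0 // invr_ge0 ltW.
by rewrite mulrC ler_pdivrMr.
Qed.

End RiccatiPerturbation.

Theorem theorem1 (R : realType) (n m : nat) (beta rho : R)
    (hatSigma : 'M[R]_(n, n + m)) (Sigma : 'M[R]_(n + m))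
    (A : 'M[R]_n) (B : 'M[R]_(n, m)) (P : 'M[R]_n)
    (n_gt0 : (0 < n)%N) (m_gt0 : (0 < m)%N)
    (beta_gt1 : 1 < beta) (rho_gt0 : 0 < rho)
    (beta_rho : 2 * beta ^+ 2 * rho * (rho + 2) < 1)
    (Sigma_pd : pdmx Sigma)
    (AB_M : Mset beta (A, B))
    (P_pd : pdmx P) (P_riccati : is_loewner_min (lqr_cost A B P) P)
    (AB_err : spectral_norm (row_mx A B - hatSigma *m invmx Sigma) <= rho) :
  exists Q : 'M[R]_(n + m),
    [/\ pdmx Q, data_riccati hatSigma Sigma Q &
        forall K : 'M[R]_(m, n), loewner_argmin (quad Q) K ->
          loewner_le (lqr_cost A B P K)
            ((1 - 2 * beta ^+ 2 * rho * (rho + 2))^-1 *: P)].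
Proof.
set G := row_mx A B in AB_err *; set Gh := hatSigma *m invmx Sigma in AB_err.
pose d := beta ^+ 2 * rho * (rho + 2).
have dE : 2 * beta ^+ 2 * rho * (rho + 2) = 2 * d by rewrite /d !mulrA.
rewrite dE in beta_rho *.
have b2_ge0 : 0 <= beta ^+ 2 := sqr_ge0 beta.
have d_gt0 : 0 < d by rewrite /d !mulr_gt0 ?exprn_gt0 //; lra.
have P_psd : psdmx P.
  case: P_pd => Ps P_pos; split=> // x.
  have [->|/P_pos/ltW //] := eqVneq x 0.
  by rewrite mulmx0 mxE.
have [Ps P_ge0] := P_psd.
case: P_riccati => K1 K1_min P_eq.
have P_le K x : qform P x <= qform (quad (qfun G P) K) x.
  by rewrite [X in qform X x]P_eq -lqr_cost_quad; exact: loewner_le_qform.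
have [P_le_b1 P_le_b2] := Mset_value_bound AB_M P_le.
have close : forall y, `|qform P (Gh *m y) - qform P (G *m y)| <= d * sqn y.
  exact: perturbed_form_close (spectral_norm_sqn AB_err).
have close1 y : qform P (Gh *m y) <= qform P (G *m y) + d * sqn y.
  by have := close y; rewrite ler_norml => /andP[]; lra.
have close2 y : qform P (G *m y) <= qform P (Gh *m y) + d * sqn y.
  by have := close y; rewrite ler_norml => /andP[]; lra.
have d1 : 0 < 1 - d by lra.
pose c := (1 - d)^-1.
have c_gt0 : 0 < c by rewrite invr_gt0.
(* The identity that makes c P a supersolution for Gh: the perturbation adds
   c d |z|^2 to the running cost |z|^2. *)
have cd : 1 + c * d = c by rewrite /c; field; rewrite gt_eqF.
have [|x|Y [Y_psd Y_le Y_min]] := @riccati_solution R n m Gh (c *: P) K1.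
- by move=> x; rewrite qformZ mulr_ge0 ?(ltW c_gt0) //; exact: P_ge0.
- rewrite qform_quad_qfun !qformZ [in leRHS]P_eq lqr_cost_quad qform_quad_qfun.
  set z := col_mx _ _.
  have := ler_wpM2l (ltW c_gt0) (close1 z).
  have : (1 + c * d) * sqn z = c * sqn z by rewrite cd.
  lra.
have [Ys Y_ge0] := Y_psd.
exists (qfun Gh Y); split; first exact: qfun_pd.
  exists Y => //.
  have [[Ss _] Su] := (Sigma_pd, pdmx_unit Sigma_pd).
  rewrite /qfun addrC addKr.
  have GS : Gh *m Sigma = hatSigma by rewrite /Gh mulmxKV.
  by rewrite -GS (trmx_mul Gh) Ss !mulmxA.
move=> K K_min; rewrite lqr_cost_quad.
apply/loewner_leP.
- exact/quad_sym/qfun_sym.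
- by rewrite linearZ /= Ps.
move=> x; case: Y_min => K' K'_min YE.
have YK y : qform (quad (qfun Gh Y) K) y <= qform Y y.
  by rewrite [in leRHS]YE; exact: loewner_le_qform.
have P_le_Y : forall y, qform P y <= (1 + d) * qform Y y.
  by apply: (@riccati_comparison _ _ _ G Gh P Y K) => //; exact: ltW.
have := YK x; rewrite !qform_quad_qfun qformZ; set z := col_mx _ _ => hY.
have hP := P_le_Y (Gh *m z); have hG := close2 z.
have hYP : (1 + d) * qform Y x <= (1 + d) * (c * qform P x).
  by rewrite ler_wpM2l -?qformZ //; lra.
have hYd : (1 + d) * (sqn z + qform Y (Gh *m z)) <= (1 + d) * qform Y x.
  by rewrite ler_wpM2l //; lra.
have hc : (1 + d) * (c * qform P x) <= (1 - 2 * d)^-1 * qform P x.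
  rewrite mulrA ler_wpM2r //; first exact: P_ge0.
  rewrite -[leRHS]mul1r ler_pdivlMr; last lra.
  rewrite /c mulrAC ler_pdivrMr // mul1r.
  by have := sqr_ge0 d; lra.
lra.
Qed.
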